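(* Let $\mathbf K$ be a class of right-angled Coxeter groups such that some $A\in\mathbf K$ has a Coxeter graph $\Gamma_A$ containing two distinct non-adjacent vertices. Then $\mathbf K$ is not first-order axiomatizable (in the language of groups).
   Context: A right-angled Coxeter group is a group with a presentation whose generating set $S$ (a Coxeter basis) satisfies only relations $s^2=e$ for $s\in S$ and $(ss')^2=e$ for some pairs of distinct $s,s'\in S$. Its Coxeter graph $\Gamma_A$ has vertex set $S$, with distinct $s,s'$ adjacent iff they commute. *)

(* Defs.v *)
From HB Require Import structures.
From mathcomp Require Import all_boot.

Set Implicit Arguments.
Unset Strict Implicit.
Unset Printing Implicit Defensive.

Local Open Scope group_scope.

(* First-order logic with equality in the language of groups. Formulas are
   well-scoped: the free variables of a formula of type [formula n] range over
   'I_n, and a quantifier binds variable [ord0], shifting the others by one. *)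

Inductive term (n : nat) : Type :=
| Var of 'I_n
| One
| Mul of term n & term n
| Inv of term n.

Arguments One {n}.

Inductive formula : nat -> Type :=
| Eq n of term n & term n : formula n
| Bot n : formula n
| And n of formula n & formula n : formula n
| Or n of formula n & formula n : formula n
| Imp n of formula n & formula n : formula n
| All n of formula n.+1 : formula n
| Ex n of formula n.+1 : formula n.

Definition sentence := formula 0.

Section Satisfaction.

(* A [baseGroupType] carries the three operations and no axiom about them, so
   it is a structure for the signature. *)
Variable M : baseGroupType.

Definition scons n (x : M) (v : 'I_n -> M) (i : 'I_n.+1) : M :=
  if unlift ord0 i is Some j then v j else x.

Fixpoint term_eval n (v : 'I_n -> M) (t : term n) : M :=
  match t with
  | Var i => v i
  | One => 1
  | Mul t1 t2 => term_eval v t1 * term_eval v t2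
  | Inv t1 => (term_eval v t1)^-1
  end.

Fixpoint holds n (f : formula n) : ('I_n -> M) -> Prop :=
  match f with
  | Eq _ t1 t2 => fun v => term_eval v t1 = term_eval v t2
  | Bot _ => fun=> False
  | And _ f1 f2 => fun v => holds f1 v /\ holds f2 v
  | Or _ f1 f2 => fun v => holds f1 v \/ holds f2 v
  | Imp _ f1 f2 => fun v => holds f1 v -> holds f2 v
  | All _ f1 => fun v => forall x, holds f1 (scons x v)
  | Ex _ f1 => fun v => exists x, holds f1 (scons x v)
  end.

Definition empty_valuation (i : 'I_0) : M := 1.

Definition satisfies (f : sentence) : Prop := holds f empty_valuation.

End Satisfaction.

Definition axiomatizable (K : groupType -> Prop) : Prop :=
  exists T : sentence -> Prop,
    forall G : groupType, K G <-> (forall f, T f -> satisfies G f).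

(* Group presentations. The letter (i, false) stands for the generator i and
   (i, true) for its formal inverse. [word_eq R] is equality in < I | R >, the
   quotient of the free group on I by the normal closure of R. *)

Definition word (I : Type) := seq (I * bool).

Inductive word_eq (I : Type) (R : word I -> Prop) : word I -> word I -> Prop :=
| word_eq_refl w : word_eq R w w
| word_eq_sym w1 w2 : word_eq R w1 w2 -> word_eq R w2 w1
| word_eq_trans w1 w2 w3 :
    word_eq R w1 w2 -> word_eq R w2 w3 -> word_eq R w1 w3
| word_eq_cancel u v i b :
    word_eq R (u ++ [:: (i, b); (i, ~~ b)] ++ v) (u ++ v)
| word_eq_relator u v r : R r -> word_eq R (u ++ r ++ v) (u ++ v).

Definition word_eval (I : Type) (G : groupType) (g : I -> G) (w : word I) : G :=
  \prod_(l <- w) (if l.2 then (g l.1)^-1 else g l.1).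

(* The homomorphism < I | R > -> G sending each generator i to [g i] is well
   defined and bijective. *)
Definition presentation (I : Type) (R : word I -> Prop) (G : groupType)
    (g : I -> G) : Prop :=
  (forall x : G, exists w, word_eval g w = x) /\
  (forall w1 w2, word_eval g w1 = word_eval g w2 <-> word_eq R w1 w2).

(* Relators s^2 for every generator s, and (s s')^2 for the pairs of distinct
   generators selected by E. *)
Inductive racg_relator (I : Type) (E : I -> I -> Prop) : word I -> Prop :=
| racg_square s : racg_relator E [:: (s, false); (s, false)]
| racg_commute s s' : s <> s' -> E s s' ->
    racg_relator E [:: (s, false); (s', false); (s, false); (s', false)].

Definition coxeter_basis (A : groupType) (S : A -> Prop) : Prop :=
  exists E : {x | S x} -> {x | S x} -> Prop,
    presentation (racg_relator E) (fun s : {x | S x} => sval s).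

Definition right_angled_coxeter (A : groupType) : Prop :=
  exists S : A -> Prop, coxeter_basis S.

(* Adjacency in the Coxeter graph attached to a basis S, whose vertex set is
   S. *)
Definition coxeter_adj (A : groupType) (S : A -> Prop) (s s' : A) : Prop :=
  [/\ S s, S s', s <> s' & commute s s'].

(* Main.v *)
(** An ultrapower of [A] satisfies every sentence true in [A], so it suffices to
    find an ultrapower of [A] that is not a right-angled Coxeter group.

    In a right-angled Coxeter group an element [x] having a [2 ^ k]-th root for
    every [k] is trivial. Fix a letter [s] of a word for [x]. The kernel of the
    parity of [s] is again a right-angled Coxeter group, on the generators
    [t] and [s t s] for [t <> s] (the two being identified when [t] commutes
    with [s]); it contains all squares, and in these generators [x] has a
    shorter word, so induction on the length of the word applies.

    If [s] and [s'] are non-commuting generators of [A] and [t = s s'], then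
    [t] has infinite order, as one sees by letting [s] and [s'] act on the
    integers as the reflections [z |-> - z] and [z |-> 1 - z]. In an ultrapower
    over a nonprincipal ultrafilter on [nat] the class of [n |-> t ^ (2 ^ n)]
    is then nontrivial and has a [2 ^ k]-th root for every [k]. *)

Require Import Defs.
From HB Require Import structures.
From mathcomp Require Import all_boot ssralg ssrint.
From mathcomp Require Import generic_quotient boolp classical_sets filter.

Set Implicit Arguments.
Unset Strict Implicit.
Unset Printing Implicit Defensive.

Local Open Scope group_scope.

(** * Words in involutive generators *)

(* Equality in the right-angled Coxeter group of E, on words without formal
   inverses; E need be neither symmetric nor irreflexive. *)
Inductive inv_eq (I : Type) (E : I -> I -> Prop) : seq I -> seq I -> Prop :=
| inv_eq_refl w : inv_eq E w w
| inv_eq_sym w1 w2 : inv_eq E w1 w2 -> inv_eq E w2 w1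
| inv_eq_trans w1 w2 w3 : inv_eq E w1 w2 -> inv_eq E w2 w3 -> inv_eq E w1 w3
| inv_eq_square u v i : inv_eq E (u ++ [:: i; i] ++ v) (u ++ v)
| inv_eq_swap u v i j : E i j ->
    inv_eq E (u ++ [:: i; j] ++ v) (u ++ [:: j; i] ++ v).

Definition word_pow (T : Type) (n : nat) (w : seq T) : seq T :=
  flatten (nseq n w).

Lemma word_powD (T : Type) m n (w : seq T) :
  word_pow (m + n) w = word_pow m w ++ word_pow n w.
Proof. by rewrite /word_pow nseqD flatten_cat. Qed.

Lemma word_powM2 (T : Type) n (w : seq T) :
  word_pow (n * 2) w = word_pow n (w ++ w).
Proof. by elim: n => //= n IHn; rewrite mulSn word_powD IHn /word_pow /= cats0. Qed.

Section InvEq.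

Variables (I : Type) (E : I -> I -> Prop).
Local Notation "u ~ v" := (inv_eq E u v) (at level 70).

Lemma inv_eq_context u v x y : x ~ y -> u ++ x ++ v ~ u ++ y ++ v.
Proof.
elim=> [w|w1 w2 _|w1 w2 w3 _ IH1 _|p q i|p q i j Eij].
- exact: inv_eq_refl.
- exact: inv_eq_sym.
- exact: inv_eq_trans.
- by rewrite -!catA !(catA u); apply: inv_eq_square.
- by rewrite -!catA !(catA u); apply: inv_eq_swap.
Qed.

Lemma inv_eq_cat x x' y y' : x ~ x' -> y ~ y' -> x ++ y ~ x' ++ y'.
Proof.
move=> xx' yy'; apply: (@inv_eq_trans _ _ _ (x' ++ y)).
  exact: (inv_eq_context [::] y).
by have := inv_eq_context x' [::] yy'; rewrite !cats0.
Qed.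

(** Substitution of words that respects the relations induces a homomorphism; [kernel_gen] will
    carry identities of the kernel back to the group this way. *)
Lemma inv_eq_flatten (T : Type) (g : T -> seq I) (e : T -> T -> Prop) x y :
  (forall i, g i ++ g i ~ [::]) ->
  (forall i j, e i j -> g i ++ g j ~ g j ++ g i) ->
  inv_eq e x y -> flatten (map g x) ~ flatten (map g y).
Proof.
move=> gsq gsw; elim=> [w|w1 w2 _|w1 w2 w3 _ IH1 _|u v i|u v i j eij].
- exact: inv_eq_refl.
- exact: inv_eq_sym.
- exact: inv_eq_trans.
- rewrite !map_cat !flatten_cat /= cats0.
  exact: inv_eq_context (gsq i).
- rewrite !map_cat !flatten_cat /= !cats0.
  exact: inv_eq_context (gsw _ _ eij).
Qed.

End InvEq.

(** * The kernel of the parity of a generator *)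

Section ParityKernel.

Variables (I : eqType) (E : I -> I -> Prop) (s : I).
Local Notation "u ~ v" := (inv_eq E u v) (at level 70).

Definition flip (b : bool) : seq I := if b then [:: s] else [::].
Definition parity (w : seq I) : bool := odd (count_mem s w).
Definition commutes_s (t : I) : bool := `[< [:: s; t] ~ [:: t; s] >].

(* (t, b) stands for the generator s^b t s^b of the kernel of parity. *)
Definition kernel_gen (p : I * bool) : seq I := flip p.2 ++ p.1 :: flip p.2.
(** Adjacency is commutation in the ambient group, so [kernel_gen] respects the relations by
    definition. *)
Definition kernel_adj (p q : I * bool) : Prop :=
  kernel_gen p ++ kernel_gen q ~ kernel_gen q ++ kernel_gen p.

(* The Schreier rewriting process, b being the parity of the letters already
   read. *)
Fixpoint kernel_word (b : bool) (w : seq I) : seq (I * bool) :=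
  if w is t :: w' then
    if t == s then kernel_word (~~ b) w'
    else (t, b && ~~ commutes_s t) :: kernel_word b w'
  else [::].

Lemma parity_cat u v : parity (u ++ v) = parity u (+) parity v.
Proof. by rewrite /parity count_cat oddD. Qed.

Lemma parity_cons t w : parity (t :: w) = (t == s) (+) parity w.
Proof. by rewrite /parity /= oddD oddb. Qed.

Lemma parity_inv_eq x y : x ~ y -> parity x = parity y.
Proof.
elim=> [w|w1 w2 _|w1 w2 w3 _ IH1 _|u v i|u v i j _] //; first by rewrite IH1.
- by rewrite !parity_cat !parity_cons addbF addbb.
- by rewrite !parity_cat !parity_cons !addbF [(i == s) (+) _]addbC.
Qed.

Lemma flip_square b : flip b ++ flip b ~ [::].
Proof.
by case: b; [exact: (inv_eq_square _ [::] [::])|exact: inv_eq_refl].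
Qed.

Lemma flip_cancel b u v : u ++ flip b ++ flip b ++ v ~ u ++ v.
Proof. by rewrite (catA (flip b)); apply: inv_eq_context (flip_square b). Qed.

Lemma kernel_gen_square p : kernel_gen p ++ kernel_gen p ~ [::].
Proof.
case: p => t b; rewrite /kernel_gen /= -catA /= -cat_rcons.
apply: (inv_eq_trans (flip_cancel _ _ _)).
rewrite cat_rcons; apply: inv_eq_trans (flip_square b).
exact: (inv_eq_square _ (flip b) (flip b)).
Qed.

(** If [t] commutes with [s], then [s t s] equals [t], and recording both as [(t, false)] keeps the
    element. *)
Lemma kernel_genE t b : kernel_gen (t, b && ~~ commutes_s t) ~ kernel_gen (t, b).
Proof.
rewrite /kernel_gen /=; case: (boolP (commutes_s t)) => [/asboolP st|_] /=.
  rewrite andbF /=; case: b => /=; last exact: inv_eq_refl.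
  apply/inv_eq_sym/(inv_eq_trans (inv_eq_context [::] [:: s] st)).
  exact: (inv_eq_square _ [:: t] [::]).
by rewrite andbT; apply: inv_eq_refl.
Qed.

(** The inner copies of [flip b] cancel, leaving the conjugates of [i j] and [j i] by [flip b]. *)
Lemma kernel_adj_gen i j b : E i j ->
  kernel_adj (i, b && ~~ commutes_s i) (j, b && ~~ commutes_s j).
Proof.
move=> Eij.
have cancel t t' : kernel_gen (t, b && ~~ commutes_s t) ++
    kernel_gen (t', b && ~~ commutes_s t') ~ flip b ++ [:: t; t'] ++ flip b.
  apply: (inv_eq_trans (inv_eq_cat (kernel_genE t b) (kernel_genE t' b))).
  rewrite /kernel_gen /= -catA /= -!(cat_rcons t).
  exact: flip_cancel.
apply: (inv_eq_trans (cancel i j)); apply: inv_eq_trans (inv_eq_sym (cancel j i)).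
exact: inv_eq_swap.
Qed.

Lemma kernel_word_cat b u v :
  kernel_word b (u ++ v) = kernel_word b u ++ kernel_word (b (+) parity u) v.
Proof.
elim: u b => [|t u IHu] b /=; first by rewrite addbF.
by rewrite parity_cons; case: eqP => _; rewrite IHu // addNb addbN.
Qed.

Lemma kernel_word_inv_eq x y : x ~ y ->
  forall b, inv_eq kernel_adj (kernel_word b x) (kernel_word b y).
Proof.
elim=> [w|w1 w2 _ IH|w1 w2 w3 _ IH1 _ IH2|u v i|u v i j Eij] b.
- exact: inv_eq_refl.
- exact: inv_eq_sym.
- exact: inv_eq_trans (IH1 b) (IH2 b).
- rewrite !kernel_word_cat !parity_cons addbF addbb addbF.
  move: (b (+) _) => c; rewrite /=.
  by case: eqP => _; [exact: inv_eq_refl|exact: inv_eq_square].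
- rewrite !kernel_word_cat !parity_cons !addbF [(i == s) (+) _]addbC.
  move: (b (+) parity u) => c /=.
  case: (eqVneq i s) => [is_s|_]; case: (eqVneq j s) => [js_s|_];
    rewrite ?eqxx /=; try exact: inv_eq_refl.
  (* Moving [s] past [j] changes the parity read before [j], but [j] commutes with [s], so its flag
     is [false] either way. *)
  + have -> : commutes_s j.
      by apply/asboolP; rewrite -is_s; apply: (inv_eq_swap [::] [::]).
    by rewrite !andbF; apply: inv_eq_refl.
  + have -> : commutes_s i.
      apply/asboolP; rewrite -js_s.
      exact/inv_eq_sym/(inv_eq_swap [::] [::]).
    by rewrite !andbF; apply: inv_eq_refl.
  + exact/inv_eq_swap/kernel_adj_gen.
Qed.

(** The product telescopes: flips between consecutive generators cancel, or leave one [s] if an odd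
    number of [s] was read there. For [b = false] and [w] even, only [w] remains. *)
Lemma kernel_wordK b w :
  flatten (map kernel_gen (kernel_word b w)) ~
    flip b ++ w ++ flip (b (+) parity w).
Proof.
elim: w b => [|t w IHw] b; first by rewrite addbF; apply/inv_eq_sym/flip_square.
rewrite parity_cons /=; case: eqP => [->|_] /=.
  apply: (inv_eq_trans (IHw _)); rewrite addNb addbN.
  case: b => /=; last exact: inv_eq_refl.
  exact/inv_eq_sym/(inv_eq_square _ [::]).
apply: (inv_eq_trans (inv_eq_cat (kernel_genE t b) (IHw b))).
by rewrite /kernel_gen /= -catA /= -!(cat_rcons t); apply: flip_cancel.
Qed.

Lemma size_kernel_word b w : size (kernel_word b w) <= size w.
Proof.
by elim: w b => //= t w IHw b; case: eqP => _ //=; apply/(leq_trans (IHw _)).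
Qed.

End ParityKernel.

Lemma inv_eq_divisible (I : eqType) (E : I -> I -> Prop) (w : seq I) :
  (forall k, exists y, inv_eq E w (word_pow (2 ^ k) y)) -> inv_eq E w [::].
Proof.
(* The alphabet is generalized too, since the induction passes to generators in [I * bool]. *)
have [n] := ubnP (size w); elim: n => // n IHn in I E w *.
case: w => [|s w] /=; first by move=> *; apply: inv_eq_refl.
rewrite ltnS => le_wn roots; set x := s :: w.
have parity_sq (y : seq I) : parity s (y ++ y) = false.
  by rewrite parity_cat addbb.
have x_even : parity s x = false.
  have [y /parity_inv_eq->] := roots 1%N.
  by rewrite (word_powM2 1) /word_pow /= cats0.
have pow_even k (y : seq I) : parity s y = false ->
    kernel_word E s false (word_pow k y) =
      word_pow k (kernel_word E s false y).
  move=> y_even; elim: k => //= k IHk.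
  by rewrite /word_pow /= kernel_word_cat y_even IHk.
have: inv_eq (kernel_adj E s) (kernel_word E s false x) [::].
  apply: IHn => [|k].
    (* The leading [s] yields no letter, so the kernel word is strictly shorter than [x]. *)
    rewrite /= eqxx; exact: leq_ltn_trans (size_kernel_word _ _ _ _) le_wn.
  (* For a [2 ^ k.+1]-th root [y], the square [y ++ y] is even, hence gives a [2 ^ k]-th root inside
     the kernel. *)
  have [y xy] := roots k.+1; exists (kernel_word E s false (y ++ y)).
  rewrite -pow_even // -word_powM2 -expnSr.
  exact: kernel_word_inv_eq.
move=> /(inv_eq_flatten (@kernel_gen_square _ _ _) (fun _ _ => id)) x1.
apply: inv_eq_trans x1; apply/inv_eq_sym.
by have := kernel_wordK E s false x; rewrite x_even /= cats0.
Qed.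

(** * Presentations *)

Lemma word_eval_cat (I : Type) (G : groupType) (g : I -> G) u v :
  word_eval g (u ++ v) = word_eval g u * word_eval g v.
Proof. by rewrite /word_eval big_cat. Qed.

Lemma word_eval_pow (I : Type) (G : groupType) (g : I -> G) n w :
  word_eval g (word_pow n w) = word_eval g w ^+ n.
Proof.
elim: n => [|n IHn]; first by rewrite /word_eval big_nil.
by rewrite expgS -IHn -word_eval_cat.
Qed.

(** Generators are involutions, so the signs of letters can be forgotten. *)
Lemma word_eq_inv_eq (I : Type) (E : I -> I -> Prop) (x y : word I) :
  word_eq (racg_relator E) x y -> inv_eq E (map fst x) (map fst y).
Proof.
elim=> [w|w1 w2 _|w1 w2 w3 _ IH1 _|u v i b|u v r].
- exact: inv_eq_refl.
- exact: inv_eq_sym.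
- exact: inv_eq_trans.
- by rewrite !map_cat; apply: inv_eq_square.
- case=> [i|i j _ Eij]; rewrite !map_cat /=; first exact: inv_eq_square.
  apply: (@inv_eq_trans _ _ _ ([seq l.1 | l <- u] ++ [:: i; i; j; j] ++
                               [seq l.1 | l <- v])).
    apply/inv_eq_sym.
    have := inv_eq_swap (rcons [seq l.1 | l <- u] i) (j :: [seq l.1 | l <- v]) Eij.
    by rewrite !cat_rcons.
  exact: inv_eq_trans (inv_eq_square _ _ _ _) (inv_eq_square _ _ _ _).
Qed.

Section RightAngledCoxeter.

Variables (I : Type) (E : I -> I -> Prop) (G : groupType) (g : I -> G).
Hypothesis presG : presentation (racg_relator E) g.

Lemma racg_relator_eval r : racg_relator E r -> word_eval g r = 1.
Proof.
move=> Rr; have /presG.2 := word_eq_relator [::] [::] Rr.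
by rewrite cats0 /= => ->; rewrite /word_eval big_nil.
Qed.

Lemma racg_gen_square i : g i * g i = 1.
Proof.
by rewrite -(racg_relator_eval (racg_square E i)) /word_eval !big_cons big_nil
           /= mulg1.
Qed.

Lemma racg_gen_inv i : (g i)^-1 = g i.
Proof. by apply: (mulgI (g i)); rewrite mulgV racg_gen_square. Qed.

Lemma racg_gen_commute i j : E i j -> g i * g j = g j * g i.
Proof.
move=> Eij; have [->//|ij] := lem (i = j).
have := racg_relator_eval (racg_commute ij Eij).
rewrite /word_eval !big_cons big_nil /= mulg1 mulgA => ij1.
by apply: (mulgI (g i * g j)); rewrite ij1 mulgA -(mulgA (g i))
   racg_gen_square mulg1 racg_gen_square.
Qed.

Lemma racg_word_evalE w : word_eval g w = \prod_(i <- map fst w) g i.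
Proof.
rewrite /word_eval big_map; apply: eq_bigr => l _.
by case: l.2; rewrite ?racg_gen_inv.
Qed.

Lemma inv_eq_prod x y :
  inv_eq E x y -> \prod_(i <- x) g i = \prod_(i <- y) g i.
Proof.
elim=> [|w1 w2 _ ->|w1 w2 w3 _ -> _ ->|u v i|u v i j Eij] //.
- by rewrite !big_cat !big_cons big_nil /= mulg1 racg_gen_square mul1g.
- by rewrite !big_cat !big_cons !big_nil /= !mulg1 racg_gen_commute.
Qed.

Lemma racg_divisible (x : G) :
  (forall k, exists y : G, x = y ^+ (2 ^ k)) -> x = 1.
Proof.
have [w <-] := presG.1 x => roots.
rewrite racg_word_evalE -[RHS](big_nil 1 *%g xpredT g).
(* [{classic I}] supplies the decidable equality used to count occurrences of a letter. *)
apply: inv_eq_prod; apply: (@inv_eq_divisible {classic I}) => k.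
have [y] := roots k; have [v <-] := presG.1 y.
rewrite -word_eval_pow => /presG.2/word_eq_inv_eq wv.
by exists (map fst v); move: wv; rewrite /word_pow map_flatten map_nseq.
Qed.

End RightAngledCoxeter.

(** * The infinite dihedral group acting on the integers *)

Section InfiniteDihedral.

Variables (I : eqType) (E : I -> I -> Prop) (s s' : I).
Hypotheses (neq_ss' : s != s') (nEss' : ~ E s s') (nEs's : ~ E s' s).

Import GRing.Theory.
Local Open Scope ring_scope.

(** Reflections in 0 and 1/2, with other generators acting trivially; the word [[:: s; s']] acts
    through [foldr] as [z |-> z - 1]. *)
Definition dihedral_act (i : I) (z : int) : int :=
  if i == s then - z else if i == s' then 1 - z else z.

(** Only the two reflections fail to commute, and [E] relates [s] and [s'] in neither order. *)
Lemma dihedral_act_inv_eq x y : inv_eq E x y ->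
  forall z, foldr dihedral_act z x = foldr dihedral_act z y.
Proof.
elim=> [|w1 w2 _ IH|w1 w2 w3 _ IH1 _ IH2|u v i|u v i j Eij] // z.
- by rewrite IH1.
- rewrite !foldr_cat /=; congr foldr; rewrite /dihedral_act.
  by case: eqP => _; [rewrite opprK|case: eqP => _ //; rewrite subKr].
- rewrite !foldr_cat /=; congr foldr; rewrite /dihedral_act.
  move: Eij; case: (eqVneq i s) => [->|_]; case: (eqVneq j s) => [->|_] //.
  + by case: (eqVneq j s') => [->|].
  + by case: (eqVneq i s') => [->|].
  + by case: (eqVneq i s') => [->|_]; case: (eqVneq j s') => [->|].
Qed.

Lemma inv_eq_dihedral_pow n : inv_eq E (word_pow n [:: s; s']) [::] -> n = 0%N.
Proof.
move=> /dihedral_act_inv_eq/(_ 0) /=.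
have -> : foldr dihedral_act 0 (word_pow n [:: s; s']) = - n%:Z.
  elim: n => //= n; rewrite /word_pow => ->.
  by rewrite /dihedral_act eqxx eq_sym (negPf neq_ss') eqxx opprK intS.
by move/eqP; rewrite oppr_eq0 => /eqP[].
Qed.

End InfiniteDihedral.

Lemma racg_infinite_order (A : groupType) (S : A -> Prop) (s s' : A) n :
  coxeter_basis S -> S s -> S s' -> s <> s' -> ~ commute s s' ->
  (s * s') ^+ n = 1 -> n = 0.
Proof.
move=> [E presA] Ss Ss' neq_ss' ncss'.
pose i : {classic {x | S x}} := exist S s Ss.
pose j : {classic {x | S x}} := exist S s' Ss'.
have -> : s * s' = word_eval (fun x : {x | S x} => sval x)
                     [:: (i, false); (j, false)].
  by rewrite /word_eval !big_cons big_nil mulg1.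
rewrite -word_eval_pow (_ : 1 = word_eval (fun x : {x | S x} => sval x) [::]);
  last by rewrite /word_eval big_nil.
move=> /presA.2/word_eq_inv_eq; rewrite /word_pow map_flatten map_nseq /=.
apply: (@inv_eq_dihedral_pow {classic {x | S x}}).
- by apply/eqP => -[].
- by move/(racg_gen_commute presA).
- by move/(racg_gen_commute presA)/esym.
Qed.

(** * Ultrapowers *)

Section Ultrapower.

Variables (A : groupType) (U : set_system nat).
Hypothesis ultraU : UltraFilter U.

Definition ae_eq (f g : nat -> A) : bool := `[< U [set n | f n = g n]%classic >].

Lemma ae_eq_refl : reflexive ae_eq.
Proof. by move=> f; apply/asboolP; apply: filterS filterT. Qed.

Lemma ae_eq_sym : symmetric ae_eq.
Proof.
by move=> f g; apply: asbool_equiv_eq; split; apply: filterS => n /= ->.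
Qed.

Lemma ae_eq_trans : transitive ae_eq.
Proof.
move=> g f h /asboolP fg /asboolP gh; apply/asboolP.
by move: fg gh; apply: filterS2 => n /= -> ->.
Qed.

Canonical ae_eq_equiv := EquivRel ae_eq ae_eq_refl ae_eq_sym ae_eq_trans.

Definition ultrapower := {eq_quot ae_eq}%qT.
HB.instance Definition _ := Choice.on ultrapower.

Definition ultraclass (f : nat -> A) : ultrapower := (\pi_({eq_quot ae_eq}) f)%qT.
Definition ultrarepr (x : ultrapower) : nat -> A := repr x.

Lemma ultrareprK x : ultraclass (ultrarepr x) = x.
Proof. exact: reprK. Qed.

Lemma ultraclass_eq f g :
  ultraclass f = ultraclass g <-> U [set n | f n = g n]%classic.
Proof. by split=> [/eqquotP/asboolP|fg] //; apply/eqquotP/asboolP. Qed.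

Lemma ultrarepr_class f : U [set n | ultrarepr (ultraclass f) n = f n]%classic.
Proof. by apply/ultraclass_eq; rewrite ultrareprK. Qed.

Definition ultra_one : ultrapower := ultraclass (fun=> 1).
Definition ultra_mul (x y : ultrapower) : ultrapower :=
  ultraclass (fun n => ultrarepr x n * ultrarepr y n).
Definition ultra_inv (x : ultrapower) : ultrapower :=
  ultraclass (fun n => (ultrarepr x n)^-1).

Lemma ultra_mulE f g :
  ultra_mul (ultraclass f) (ultraclass g) = ultraclass (fun n => f n * g n).
Proof.
apply/ultraclass_eq; move: (ultrarepr_class f) (ultrarepr_class g).
by apply: filterS2 => n /= -> ->.
Qed.

Lemma ultra_invE f : ultra_inv (ultraclass f) = ultraclass (fun n => (f n)^-1).
Proof.
apply/ultraclass_eq; move: (ultrarepr_class f).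
by apply: filterS => n /= ->.
Qed.

Lemma ultra_mulA : associative ultra_mul.
Proof.
move=> x y z; rewrite -(ultrareprK x) -(ultrareprK y) -(ultrareprK z) !ultra_mulE.
by congr ultraclass; apply/funext => n; rewrite mulgA.
Qed.

Lemma ultra_mul1g : left_id ultra_one ultra_mul.
Proof.
move=> x; rewrite -(ultrareprK x) ultra_mulE.
by congr ultraclass; apply/funext => n; rewrite mul1g.
Qed.

Lemma ultra_mulg1 : right_id ultra_one ultra_mul.
Proof.
move=> x; rewrite -(ultrareprK x) ultra_mulE.
by congr ultraclass; apply/funext => n; rewrite mulg1.
Qed.

Lemma ultra_mulVg : left_inverse ultra_one ultra_inv ultra_mul.
Proof.
move=> x; rewrite -(ultrareprK x) ultra_invE ultra_mulE.
by congr ultraclass; apply/funext => n; rewrite mulVg.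
Qed.

Lemma ultra_mulgV : right_inverse ultra_one ultra_inv ultra_mul.
Proof.
move=> x; rewrite -(ultrareprK x) ultra_invE ultra_mulE.
by congr ultraclass; apply/funext => n; rewrite mulgV.
Qed.

HB.instance Definition _ := isGroup.Build ultrapower
  ultra_mulA ultra_mul1g ultra_mulg1 ultra_mulVg ultra_mulgV.

Lemma ultraclassX f k : ultraclass f ^+ k = ultraclass (fun n => f n ^+ k).
Proof.
elim: k => // k IHk; rewrite expgS IHk [LHS]ultra_mulE.
by congr ultraclass; apply/funext => n; rewrite expgS.
Qed.

Lemma ultra_term_eval m (t : term m) (v : 'I_m -> nat -> A) :
  term_eval (fun i => ultraclass (v i)) t =
    ultraclass (fun n => term_eval (fun i => v i n) t).
Proof.
by elim: t => [i||t1 /= -> t2 ->|t /= ->] //; [apply: ultra_mulE|apply: ultra_invE].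
Qed.

Lemma scons_ultraclass m (f : nat -> A) (v : 'I_m -> nat -> A) :
  scons (ultraclass f) (fun i => ultraclass (v i)) =
    (fun i => ultraclass (fun n => scons (f n) (fun j => v j n) i)).
Proof. by apply/funext => i; rewrite /scons; case: unlift. Qed.

(** Induction on the formula: the ultrafilter dichotomy handles disjunction and implication, and
    pointwise choice the quantifiers. *)
Theorem los m (phi : formula m) (v : 'I_m -> nat -> A) :
  holds phi (fun i => ultraclass (v i)) <->
    U [set n | holds phi (fun i => v i n)]%classic.
Proof.
elim: phi v => {m} [m t1 t2|m|m f1 IH1 f2 IH2|m f1 IH1 f2 IH2|m f1 IH1 f2 IH2
                   |m f IH|m f IH] v /=.
- by rewrite !ultra_term_eval ultraclass_eq.
- by split=> // /filter_ex[].
- rewrite IH1 IH2; split=> [[]|U12]; first exact: filterI.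
  by split; move: U12; apply: filterS => n [].
- rewrite IH1 IH2; split=> [[]|U12]; try by apply: filterS => n /=; tauto.
  have [U1|nU1] := in_ultra_setVsetC
    [set n | holds f1 (fun i => v i n)]%classic ultraU; first by left.
  by right; move: U12 nU1; apply: filterS2 => n [].
- rewrite IH1 IH2; split=> [U12|U12 U1]; last first.
    by move: U12 U1; apply: filterS2 => n; apply.
  have [/U12|] := in_ultra_setVsetC
    [set n | holds f1 (fun i => v i n)]%classic ultraU.
    by apply: filterS => n f2n _.
  by apply: filterS => n nf1 /nf1.
- split=> [Uf|Uf x]; last first.
    rewrite -(ultrareprK x) scons_ultraclass IH.
    by move: Uf; apply: filterS => n; apply.
  have [//|Unf] := in_ultra_setVsetC
    [set n | forall x, holds f (scons x (fun i => v i n))]%classic ultraU.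
  (* [w n] is a counterexample at [n] whenever one exists, so truth at [w n] gives truth
     everywhere. *)
  have /choice[w wP] n : exists y, holds f (scons y (fun i => v i n)) ->
      forall x, holds f (scons x (fun i => v i n)).
    have [Hall|/existsNP[x nfx]] :=
      lem (forall x, holds f (scons x (fun i => v i n))).
      by exists 1.
    by exists x.
  have := Uf (ultraclass w); rewrite scons_ultraclass IH.
  by apply: filterS => n /wP.
- split=> [[x]|Uf].
    rewrite -(ultrareprK x) scons_ultraclass IH.
    by apply: filterS => n fx; exists (ultrarepr x n).
  have /choice[w wP] n : exists y,
      (exists x, holds f (scons x (fun i => v i n))) ->
      holds f (scons y (fun i => v i n)).
    have [[x fx]|nfx] := lem (exists x, holds f (scons x (fun i => v i n))).
      by exists x.
    by exists 1 => /nfx.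
  exists (ultraclass w); rewrite scons_ultraclass IH.
  by move: Uf; apply: filterS => n /wP.
Qed.

Lemma ultrapower_satisfies (phi : sentence) :
  satisfies A phi -> satisfies ultrapower phi.
Proof.
rewrite /satisfies => Aphi.
have -> : @empty_valuation ultrapower =
    fun i => ultraclass (fun=> empty_valuation A i).
  by apply/funext => -[].
by apply/los; apply: filterS filterT => n _.
Qed.

Lemma ultrapower_divisible_neq1 (t : A) : (\oo `<=` U)%classic ->
  (forall n, t ^+ (2 ^ n) <> 1) ->
  exists2 x : ultrapower, x <> 1 & forall k, exists y, x = y ^+ (2 ^ k).
Proof.
move=> ooU t_neq1; exists (ultraclass (fun n => t ^+ (2 ^ n))) => [|k].
  by move=> /ultraclass_eq/filter_ex[n]; exact: t_neq1.
(* The subtraction is truncated, so the power is right only for [n >= k]; this cofinite set belongs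
   to [U]. *)
exists (ultraclass (fun n => t ^+ (2 ^ (n - k)))); rewrite ultraclassX.
apply/ultraclass_eq/ooU; exists k => // n /= le_kn.
by rewrite -expgnA -expnD subnK.
Qed.

End Ultrapower.

Theorem theorem3p3 (K : groupType -> Prop)
    (K_racg : forall A : groupType, K A -> right_angled_coxeter A)
    (K_nonadj : exists A : groupType, K A /\
       exists S : A -> Prop, coxeter_basis S /\
       exists s s' : A, [/\ S s, S s', s <> s' & ~ coxeter_adj S s s']) :
  ~ axiomatizable K.
Proof.
move=> [T KT].
have [A [KA [S [basisS [s [s' [Ss Ss' neq_ss' nadj]]]]]]] := K_nonadj.
have ncss' : ~ commute s s' by move=> css'; apply: nadj; split.
(* Extending the cofinite filter makes [U] nonprincipal. *)
have [U [ultraU ooU]] := ultraFilterLemma eventually_filter.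
have t_neq1 n : (s * s') ^+ (2 ^ n) <> 1.
  by move/(racg_infinite_order basisS Ss Ss' neq_ss' ncss')/eqP;
     rewrite expn_eq0.
have [x x_neq1 x_div] := ultrapower_divisible_neq1 ultraU ooU t_neq1.
(* The ultrapower inherits [T] from [A], so it lies in [K]. *)
have /K_racg[S' [E presS']] : K (ultrapower A ultraU).
  by apply/KT => f Tf; apply/ultrapower_satisfies; move: f Tf; apply/KT.
exact/x_neq1/(racg_divisible presS').
Qed.
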